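(* Let $a\in\mathbb{C}\setminus\{0\}$, $\mu\in\mathbb{C}$ and $x\in\{0,1,2,\dots\}$. Then the fractional Charlier function $C_\mu(x;a)$ satisfies $$C_\mu(x;a)={}_2F_0\left(-\mu,-x;-;-\frac1a\right)=\sum_{j=0}^{\infty}\frac{(-\mu)_j(-x)_j}{j!}\left(-\frac1a\right)^j .$$ (The series terminates because $(-x)_j=0$ for $j>x$.)
   Context: In the claim, $(z)_0=1$ and $(z)_j=z(z+1)\cdots(z+j-1)$ for $j\ge1$. Gray--Zhang fractional difference: for $\mu\in\mathbb{C}$, an integer $b$ and an integer $t\ge b$, the $\mu$-th order difference of $f$ over $\{b,b+1,\dots,t\}$ is $$\nabla_{b,t}^{\mu}f(t)=\frac{1}{\Gamma(n-\mu)}\nabla^n\left[\sum_{k=b}^{t}(t-k+1)_{n-\mu-1}f(k)\right],$$ where $n=\max\{0,n_0\}$, $n_0$ is the integer with $0<\mathrm{Re}(n_0-\mu)\le1$, $\nabla g(t)=g(t)-g(t-1)$ acts on the bracket as a function of $t$ (a sum with upper limit smaller than $b$ being $0$), and for complex index $s$, $(z)_s=\Gamma(z+s)/\Gamma(z)$ when $z$ and $z+s$ are not in $\{0,-1,-2,\dots\}$. The fractional Charlier function is defined for $x\in\{0,1,2,\dots\}$ by $$C_\mu(x;a)=\frac{x!}{a^x}\,\nabla_{0,x}^{\mu}\left[\frac{a^x}{x!}\right],$$ i.e. the $\mu$-th order difference over $\{0,1,\dots,x\}$ of the function $k\mapsto a^k/k!$, evaluated at $x$. *)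

(* Defs.v *)
From Stdlib Require Export Reals ZArith Lra.
From Coquelicot Require Export Coquelicot.

Open Scope C_scope.

(* Componentwise limit; meaningful when the sequence converges, in which case
   it is the limit in C (see [Clim_seq_unique]). *)
Definition Clim_seq (u : nat -> C) : C :=
  (real (Lim_seq (fun n => Re (u n))), real (Lim_seq (fun n => Im (u n)))).

Lemma Clim_seq_unique (u : nat -> C) (l : C) :
  filterlim u eventually (locally l) -> Clim_seq u = l.
Proof.
intros H; destruct l as [a b]; unfold Clim_seq.
assert (Ha : is_lim_seq (fun n => Re (u n)) a).
{ intros P [e He].
  apply (H (fun z : C => P (Re z))); exists e; intros y [Hy _]; apply He, Hy. }
assert (Hb : is_lim_seq (fun n => Im (u n)) b).
{ intros P [e He].
  apply (H (fun z : C => P (Im z))); exists e; intros y [_ Hy]; apply He, Hy. }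
now rewrite (is_lim_seq_unique _ _ Ha), (is_lim_seq_unique _ _ Hb).
Qed.

Definition Cexp (z : C) : C :=
  (exp (Re z) * cos (Im z), exp (Re z) * sin (Im z))%R.

Fixpoint rising (z : C) (j : nat) : C :=
  match j with
  | O => 1
  | S j' => rising z j' * (z + INR j')
  end.

(* Gauss's product formula
     Gamma(z) = lim_n  n! n^z / (z (z+1) ... (z+n)),
   valid at every z not in {0,-1,-2,...}; the value at a pole is junk. *)
Definition CGamma (z : C) : C :=
  Clim_seq (fun n =>
    INR (fact n) * Cexp (z * ln (INR n)) / rising z (S n)).

(* (z)_s for a complex index s; meaningful when neither z nor z + s is in
   {0,-1,-2,...}. *)
Definition Cpoch (z s : C) : C := CGamma (z + s) / CGamma z.

Definition nabla (g : Z -> C) (t : Z) : C := g t - g (t - 1)%Z.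

Definition sumZ (b t : Z) (F : Z -> C) : C :=
  if (t <? b)%Z then 0
  else sum_n (fun i : nat => F (b + Z.of_nat i)%Z) (Z.to_nat (t - b)).

(* [up (Re mu)] is the integer n0 with 0 < Re (n0 - mu) <= 1 (see
   [up_Re_spec]) and [Z.to_nat] truncates negative integers to 0. *)
Definition diff_order (mu : C) : nat := Z.to_nat (up (Re mu)).

Lemma up_Re_spec (mu : C) (n0 : Z) :
  (0 < Re (IZR n0 - mu) <= 1)%R <-> n0 = up (Re mu).
Proof.
change (Re (IZR n0 - mu)) with (IZR n0 - Re mu)%R; split.
- intros [H1 H2]; apply tech_up; lra.
- intros ->; destruct (archimed (Re mu)) as [H1 H2]; lra.
Qed.

(* The Gray-Zhang difference of order mu over {b, b+1, ..., t}, for b <= t.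
   The lower limit b is fixed while [nabla] acts on the upper limit, which may
   drop below b, where the sum is 0. *)
Definition gray_zhang (mu : C) (b : Z) (f : Z -> C) (t : Z) : C :=
  let n := diff_order mu in
  / CGamma (INR n - mu) *
  Nat.iter n nabla
    (fun s : Z =>
       sumZ b s (fun k : Z => Cpoch (IZR (s - k + 1)) (INR n - mu - 1) * f k))
    t.

(* Only the values of the differenced function at k >= 0 are used. *)
Definition charlier (mu : C) (x : nat) (a : C) : C :=
  INR (fact x) / Cpow a x *
  gray_zhang mu 0
    (fun k : Z => Cpow a (Z.to_nat k) / INR (fact (Z.to_nat k)))
    (Z.of_nat x).

Definition hyp2F0_term (p q z : C) (j : nat) : C :=
  rising p j * rising q j / INR (fact j) * Cpow z j.

Definition is_hyp2F0 (p q z l : C) : Prop :=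
  is_series (hyp2F0_term p q z : nat -> C_NormedModule) l.

(* Main.v *)
Require Import Defs.
From Stdlib Require Import Lia Psatz.

(** The sequence [rising s j / j!] is the coefficient sequence of
    (1 - X)^(-s), so convolving with it is a summation of order s, and one
    backward difference multiplies by (1 - X), that is, lowers s to s - 1
    ([nabla_rising_conv]).  The kernel of the Gray-Zhang difference is, up to
    the factor Gamma(n - mu), exactly this sequence for s = n - mu:
    Gamma(j + s) / Gamma(j + 1) = Gamma(s) (s)_j / j!  ([Cpoch_nat]).  Dividing
    by Gamma(s) and differencing n times therefore leaves the convolution with
    the coefficients of order -mu ([gray_zhang_eq]):

      sum over i <= x of  (-mu)_(x-i) / (x-i)!  f(i).

    For f(i) = a^i / i!, reversing the sum by j = x - i and using
    (-x)_j = (-1)^j x! / (x-j)!  ([rising_neg_INR]) gives the terms of the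
    hypergeometric series up to j = x, and the remaining terms vanish.

    The analytic content is that Gauss's product behaves like Gamma at every s
    with Re s > 0, which holds for s = n - mu by the choice of n: it converges,
    its limit is nonzero, and Gamma(s + 1) = s Gamma(s).  Consecutive terms of
    Gauss's sequence differ by a factor
    exp(-s ln((m+1)/m)) (1 + s/(m+1)) = 1 + O(1/m^2)  ([gauss_defect_bound]),
    and an infinite product of such factors converges to a nonzero number
    ([Ccv_nonzero_of_summable_ratios]). *)

(** * Convergence of complex sequences and infinite products *)

Lemma Cmod_Im_le (z : C) : (Rabs (Im z) <= Cmod z)%R.
Proof. eapply Rle_trans; [ apply Rmax_r | apply Rmax_Cmod ]. Qed.

Lemma Cmod_le_Re_Im (z : C) : (Cmod z <= Rabs (Re z) + Rabs (Im z))%R.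
Proof.
replace z with (RtoC (Re z) + Ci * RtoC (Im z)) at 1.
- eapply Rle_trans; [ apply Cmod_triangle | ].
  rewrite Cmod_mult, Cmod_Ci, !Cmod_R; lra.
- destruct z as [x y]; unfold Cplus, Cmult, Ci, RtoC; simpl; f_equal; ring.
Qed.

Lemma Cmod_sqr (z : C) : (Cmod z ^ 2 = Re z ^ 2 + Im z ^ 2)%R.
Proof.
unfold Cmod; rewrite <- Rsqr_pow2, Rsqr_sqrt; [ reflexivity | ].
apply Rplus_le_le_0_compat; apply pow2_ge_0.
Qed.

Lemma Cmod_near_one (d : C) : (Cmod d <= 1 / 2)%R -> (1 / 2 <= Cmod (1 + d))%R.
Proof.
intros H.
pose proof (Cmod_triangle (1 + d) (- d)) as T.
rewrite Cmod_opp in T; replace (1 + d + - d) with (RtoC 1) in T by ring.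
rewrite Cmod_1 in T; lra.
Qed.

(** Convergence is taken componentwise, as [Clim_seq] is: the limit laws then
    reduce to those of real sequences. *)
Definition Ccv (u : nat -> C) (l : C) : Prop :=
  is_lim_seq (fun n => Re (u n)) (Re l) /\ is_lim_seq (fun n => Im (u n)) (Im l).

Lemma Ccv_Clim_seq u l : Ccv u l -> Clim_seq u = l.
Proof.
intros [Hr Hi]; unfold Clim_seq.
rewrite (is_lim_seq_unique _ _ Hr), (is_lim_seq_unique _ _ Hi).
now destruct l.
Qed.

Lemma Ccv_unique u l m : Ccv u l -> Ccv u m -> l = m.
Proof. intros Hl Hm; rewrite <- (Ccv_Clim_seq _ _ Hl); apply Ccv_Clim_seq, Hm. Qed.

Lemma Ccv_ext_loc u v l :
  eventually (fun n => u n = v n) -> Ccv u l -> Ccv v l.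
Proof.
intros E [Hr Hi]; split.
- refine (is_lim_seq_ext_loc _ _ _ _ Hr); destruct E as [N E]; exists N.
  now intros n Hn; rewrite E.
- refine (is_lim_seq_ext_loc _ _ _ _ Hi); destruct E as [N E]; exists N.
  now intros n Hn; rewrite E.
Qed.

Lemma Ccv_const l : Ccv (fun _ => l) l.
Proof. split; apply is_lim_seq_const. Qed.

Lemma Ccv_mult u v l m : Ccv u l -> Ccv v m -> Ccv (fun n => u n * v n) (l * m).
Proof.
intros [Hur Hui] [Hvr Hvi]; split.
- exact (is_lim_seq_minus' _ _ _ _ (is_lim_seq_mult' _ _ _ _ Hur Hvr)
           (is_lim_seq_mult' _ _ _ _ Hui Hvi)).
- exact (is_lim_seq_plus' _ _ _ _ (is_lim_seq_mult' _ _ _ _ Hur Hvi)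
           (is_lim_seq_mult' _ _ _ _ Hui Hvr)).
Qed.

Lemma Ccv_of_shift u N l : Ccv (fun n => u (n + N)%nat) l -> Ccv u l.
Proof.
intros [Hr Hi]; split.
- now apply (is_lim_seq_incr_n (fun n => Re (u n)) N).
- now apply (is_lim_seq_incr_n (fun n => Im (u n)) N).
Qed.

Lemma Ccv_of_dist_le u l (b : nat -> R) :
  eventually (fun n => (Cmod (u n - l) <= b n)%R) -> is_lim_seq b 0 -> Ccv u l.
Proof.
intros [N HN] Hb.
assert (aux : forall f : C -> R, (forall z, Rabs (f z) <= Cmod z)%R ->
   (forall z w : C, f (z - w) = (f z - f w)%R) -> is_lim_seq (fun n => f (u n)) (f l)).
{ intros f Hf Hm.
  assert (H0 : is_lim_seq (fun n => f (u n) - f l)%R 0).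
  { apply is_lim_seq_abs_0.
    apply (is_lim_seq_le_le_loc (fun _ => 0%R) _ b).
    - exists N; intros n Hn; split; [ apply Rabs_pos | ]; cbv beta.
      rewrite <- Hm; eapply Rle_trans; [ apply Hf | apply HN, Hn ].
    - apply is_lim_seq_const.
    - exact Hb. }
  pose proof (is_lim_seq_plus' _ _ _ _ H0 (is_lim_seq_const (f l))) as H1.
  rewrite Rplus_0_l in H1.
  refine (is_lim_seq_ext _ _ _ _ H1); intros n; simpl; ring. }
split; apply aux.
- apply re_le_Cmod.
- intros z w; reflexivity.
- apply Cmod_Im_le.
- intros z w; reflexivity.
Qed.

Lemma sum_n_increments (u : nat -> R) n :
  sum_n (fun k => u (S k) - u k)%R n = (u (S n) - u O)%R.
Proof.
induction n as [|n IH].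
- now rewrite sum_O.
- rewrite sum_Sn, IH; unfold plus; simpl; ring.
Qed.

Lemma ex_lim_of_summable_increments (u b : nat -> R) :
  ex_series b -> (forall n, Rabs (u (S n) - u n) <= b n)%R ->
  exists l : R, is_lim_seq u l.
Proof.
intros Hb Hu.
destruct (ex_series_le (fun n => u (S n) - u n)%R b Hu Hb) as [l Hl].
exists (l + u O)%R; apply is_lim_seq_incr_1.
change (is_lim_seq (sum_n (fun k => u (S k) - u k)%R) l) in Hl.
refine (is_lim_seq_ext _ _ _ _ (is_lim_seq_plus' _ _ _ _ Hl (is_lim_seq_const (u O)))).
intros n; cbv beta; rewrite sum_n_increments; ring.
Qed.

(** The growth condition first bounds u, since |u (n+1)| <= exp(e n) |u n|
    gives |u n| <= |u 0| exp(sum e).  With this bound the increments of u are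
    themselves absolutely summable. *)
Lemma Ccv_of_summable_growth (u : nat -> C) (e : nat -> R) :
  ex_series e -> (forall n, 0 <= e n)%R ->
  (forall n, Cmod (u (S n) - u n) <= e n * Cmod (u n))%R ->
  exists l, Ccv u l.
Proof.
intros He He0 Hu.
assert (Hbound : forall n, (Cmod (u n) <= Cmod (u O) * exp (Series e))%R).
{ assert (Hpart : forall n, (sum_n e n <= Series e)%R).
  { intros n.
    refine (is_lim_seq_incr_compare (sum_n e) (Series e) _ _ n).
    - exact (Series_correct _ He).
    - intros k; rewrite sum_Sn; unfold plus; simpl; specialize (He0 (S k)); lra. }
  assert (Hstep : forall n, (Cmod (u (S n)) <= Cmod (u n) * exp (e n))%R).
  { intros n.
    pose proof (Cmod_triangle (u n) (u (S n) - u n)) as T.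
    replace (u n + (u (S n) - u n)) with (u (S n)) in T by ring.
    pose proof (exp_ineq1_le (e n)); specialize (Hu n).
    pose proof (Cmod_ge_0 (u n)); nra. }
  assert (HS : forall n, (Cmod (u (S n)) <= Cmod (u O) * exp (sum_n e n))%R).
  { intros n; induction n as [|n IH].
    - rewrite sum_O; apply Hstep.
    - eapply Rle_trans; [ apply Hstep | ].
      rewrite sum_Sn; unfold plus; simpl; rewrite exp_plus, <- Rmult_assoc.
      apply Rmult_le_compat_r; [ left; apply exp_pos | exact IH ]. }
  assert (Hexp : forall n, (exp (sum_n e n) <= exp (Series e))%R).
  { intros n; destruct (Hpart n) as [H|H]; [ left; now apply exp_increasing | ].
    rewrite H; apply Rle_refl. }
  assert (H1 : (1 <= exp (Series e))%R).
  { rewrite <- exp_0; specialize (Hpart O); rewrite sum_O in Hpart.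
    specialize (He0 O); pose proof (exp_ineq1_le (Series e)); rewrite exp_0; lra. }
  intros [|n].
  - pose proof (Cmod_ge_0 (u O)); nra.
  - eapply Rle_trans; [ apply HS | ].
    apply Rmult_le_compat_l; [ apply Cmod_ge_0 | apply Hexp ]. }
set (M := (Cmod (u O) * exp (Series e))%R) in *.
assert (Hb : ex_series (fun n => M * e n)%R).
{ exact (ex_series_scal_l M e He). }
assert (Hinc : forall n, (Cmod (u (S n) - u n) <= M * e n)%R).
{ intros n; specialize (Hu n); specialize (He0 n); specialize (Hbound n); nra. }
destruct (ex_lim_of_summable_increments (fun n => Re (u n)) _ Hb) as [x Hx].
{ intros n; eapply Rle_trans; [ apply (re_le_Cmod (u (S n) - u n)) | apply Hinc ]. }
destruct (ex_lim_of_summable_increments (fun n => Im (u n)) _ Hb) as [y Hy].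
{ intros n; eapply Rle_trans; [ apply (Cmod_Im_le (u (S n) - u n)) | apply Hinc ]. }
now exists (x, y).
Qed.

(** Both u and 1/u satisfy the growth condition of
    [Ccv_of_summable_growth], because |d n| <= 1/2 keeps 1 + d n away from 0;
    the product of their limits is 1, so the limit of u cannot be 0. *)
Lemma Ccv_nonzero_of_summable_ratios (u d : nat -> C) (e : nat -> R) :
  ex_series e -> (forall n, Cmod (d n) <= e n <= 1 / 2)%R ->
  (forall n, u n <> 0) -> (forall n, u n = u (S n) * (1 + d n)) ->
  exists l : C, l <> 0 /\ Ccv u l.
Proof.
intros He Hd Hu0 Hu.
assert (He0 : forall n, (0 <= e n)%R).
{ intros n; eapply Rle_trans; [ apply (Cmod_ge_0 (d n)) | apply Hd ]. }
destruct (Ccv_of_summable_growth u (fun n => 2 * e n)%R) as [l Hl].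
{ exact (ex_series_scal_l 2%R e He). }
{ intros n; specialize (He0 n); lra. }
{ intros n.
  replace (u (S n) - u n) with (- (d n * u (S n))) by (rewrite (Hu n); ring).
  rewrite Cmod_opp, Cmod_mult, (Hu n), Cmod_mult.
  destruct (Hd n) as [H1 H2].
  assert (H3 := Cmod_near_one (d n) ltac:(lra)).
  pose proof (Cmod_ge_0 (u (S n))); pose proof (Cmod_ge_0 (d n)).
  assert (Cmod (u (S n)) <= 2 * (Cmod (u (S n)) * Cmod (1 + d n)))%R by nra.
  nra. }
destruct (Ccv_of_summable_growth (fun n => / u n) e He He0) as [m Hm].
{ intros n.
  assert (Hf : 1 + d n <> 0).
  { intros H; apply (Hu0 n); rewrite Hu, H; ring. }
  replace (/ u (S n) - / u n) with (d n * / u n).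
  - rewrite Cmod_mult; apply Rmult_le_compat_r; [ apply Cmod_ge_0 | apply Hd ].
  - rewrite (Hu n); field; split; [ exact Hf | apply Hu0 ]. }
exists l; split; [ | exact Hl ].
intros ->.
assert (H1 : Ccv (fun _ => 1) (0 * m)).
{ refine (Ccv_ext_loc _ _ _ _ (Ccv_mult _ _ _ _ Hl Hm)).
  exists O; intros n _; apply Cinv_r, Hu0. }
pose proof (Ccv_unique _ _ _ H1 (Ccv_const 1)) as H2.
rewrite Cmult_0_l in H2.
apply (f_equal Re) in H2; simpl in H2; lra.
Qed.

(** * The complex exponential near the origin *)

Lemma Cexp_plus z w : Cexp (z + w) = Cexp z * Cexp w.
Proof.
destruct z as [x y], w as [x' y']; unfold Cexp; simpl.
rewrite exp_plus, sin_plus, cos_plus; unfold Cmult; simpl; f_equal; ring.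
Qed.

Lemma Cexp_0 : Cexp 0 = 1.
Proof. unfold Cexp; simpl; rewrite exp_0, sin_0, cos_0; unfold RtoC; f_equal; ring. Qed.

Lemma Cexp_neq_0 z : Cexp z <> 0.
Proof.
intros H; apply (f_equal (fun w => w * Cexp (- z))) in H.
rewrite <- Cexp_plus, Cplus_opp_r, Cexp_0, Cmult_0_l in H.
apply (f_equal Re) in H; simpl in H; lra.
Qed.

Lemma Cexp_RtoC x : Cexp (RtoC x) = RtoC (exp x).
Proof. unfold Cexp; simpl; rewrite cos_0, sin_0; unfold RtoC; f_equal; ring. Qed.

(** The upper bound comes from exp(-x) >= 1 - x, that is,
    exp x <= 1 / (1 - x). *)
Lemma exp_sub_one_le x : (Rabs x <= 1 / 2 -> 0 <= exp x - 1 - x <= 2 * x ^ 2)%R.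
Proof.
intros H; apply Rabs_le_between in H.
pose proof (exp_ineq1_le x); pose proof (exp_ineq1_le (- x)).
split; [ lra | ].
assert (E : (exp x * exp (- x) = 1)%R) by (rewrite <- exp_plus, Rplus_opp_r; apply exp_0).
pose proof (exp_pos x).
assert (exp x * (1 - x) <= 1)%R by nra.
assert ((1 + x + 2 * x ^ 2) * (1 - x) >= 1)%R by nra.
nra.
Qed.

(** Half-angle formula 1 - cos y = 2 sin^2 (y/2), with |sin t| <= |t|. *)
Lemma one_sub_cos_le y : (0 <= 1 - cos y <= y ^ 2 / 2)%R.
Proof.
assert (Hs : forall t, (sin t ^ 2 <= t ^ 2)%R).
{ intros t; pose proof (SIN_bound t).
  destruct (Rle_lt_dec 0 t) as [Ht|Ht].
  - destruct (Rle_lt_dec t 1) as [H1|H1]; [ | nra ].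
    pose proof (sin_ge_0 t Ht ltac:(pose proof PI2_3_2; lra)).
    destruct Ht as [Ht|<-]; [ pose proof (sin_lt_x t Ht); nra | rewrite sin_0; lra ].
  - destruct (Rle_lt_dec (- t) 1) as [H1|H1]; [ | nra ].
    pose proof (sin_ge_0 (- t) ltac:(lra) ltac:(pose proof PI2_3_2; lra)).
    pose proof (sin_lt_x (- t) ltac:(lra)); rewrite sin_neg in *; nra. }
pose proof (COS_bound y); split; [ lra | ].
replace y with (2 * (y / 2))%R at 1 by field.
rewrite cos_2a_sin; specialize (Hs (y / 2)%R); nra.
Qed.

Lemma sin_sub_id_le y : (Rabs (sin y - y) <= y ^ 2 / 2 * Rabs y)%R.
Proof.
destruct (MVT_gen (fun t => sin t - t)%R 0 y (fun t => cos t - 1)%R) as [c [Hc E]].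
- intros t _; auto_derive; [ exact I | ring ].
- intros t _; apply continuity_pt_minus; [ apply continuity_sin | apply continuity_pt_id ].
- rewrite sin_0 in E; replace (sin y - y)%R with ((cos c - 1) * y)%R by lra.
  rewrite Rabs_mult; apply Rmult_le_compat_r; [ apply Rabs_pos | ].
  pose proof (one_sub_cos_le c).
  rewrite Rabs_minus_sym, Rabs_pos_eq by lra.
  assert (c ^ 2 <= y ^ 2)%R; [ | lra ].
  unfold Rmin, Rmax in Hc; destruct (Rle_dec 0 y); nra.
Qed.

Lemma Cexp_sub_one_le w :
  (Cmod w <= 1 / 2 -> Cmod (Cexp w - 1 - w) <= 3 * Cmod w ^ 2)%R.
Proof.
intros H.
pose proof (Rle_trans _ _ _ (re_le_Cmod w) H) as Hx.
pose proof (Rle_trans _ _ _ (Cmod_Im_le w) H) as Hy.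
eapply Rle_trans; [ apply Cmod_le_Re_Im | ].
rewrite Cmod_sqr; destruct w as [x y]; simpl Re in *; simpl Im in *.
change (Re (Cexp (x, y) - 1 - (x, y))) with (exp x * cos y - 1 - x)%R.
change (Im (Cexp (x, y) - 1 - (x, y))) with (exp x * sin y - 0 - y)%R.
pose proof (exp_sub_one_le x Hx) as He.
pose proof (one_sub_cos_le y) as Hc.
pose proof (sin_sub_id_le y) as Hs.
apply Rabs_le_between in Hx.
assert (Hex : (exp x <= 2)%R) by nra.
pose proof (exp_pos x).
assert (A : (Rabs (exp x * cos y - 1 - x) <= 2 * x ^ 2 + y ^ 2)%R).
{ replace (exp x * cos y - 1 - x)%R
    with ((exp x - 1 - x) - exp x * (1 - cos y))%R by ring.
  apply Rabs_le; nra. }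
assert (Hs' : (Rabs (sin y - y) <= y ^ 2 / 4)%R).
{ eapply Rle_trans; [ exact Hs | ]. pose proof (pow2_ge_0 y); nra. }
assert (B : (Rabs (exp x * sin y - 0 - y) <= x ^ 2 + 2 * y ^ 2)%R).
{ replace (exp x * sin y - 0 - y)%R
    with ((exp x - 1) * y + exp x * (sin y - y))%R by ring.
  eapply Rle_trans; [ apply Rabs_triang | ]; rewrite !Rabs_mult.
  assert (H1 : (Rabs (exp x - 1) <= 2 * Rabs x)%R).
  { unfold Rabs; destruct (Rcase_abs x), (Rcase_abs (exp x - 1)); nra. }
  rewrite (Rabs_pos_eq (exp x)) by lra.
  assert (Rabs (exp x - 1) * Rabs y <= x ^ 2 + y ^ 2)%R.
  { rewrite <- (pow2_abs x), <- (pow2_abs y).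
    pose proof (Rabs_pos y); pose proof (Rabs_pos x).
    pose proof (pow2_ge_0 (Rabs x - Rabs y)). nra. }
  assert (exp x * Rabs (sin y - y) <= y ^ 2)%R.
  { pose proof (Rabs_pos (sin y - y)); nra. }
  lra. }
unfold Rminus in A, B; lra.
Qed.

(** * Rising factorials *)

Lemma RtoC_INR_S n : RtoC (INR (S n)) = INR n + 1.
Proof. now rewrite S_INR, RtoC_plus. Qed.

Lemma RtoC_INR_S_neq_0 n : RtoC (INR (S n)) <> 0.
Proof. intros H; apply RtoC_inj in H; revert H; apply not_0_INR, Nat.neq_succ_0. Qed.

Lemma RtoC_INR_fact_S n : RtoC (INR (fact (S n))) = INR (S n) * INR (fact n).
Proof. rewrite <- RtoC_mult, <- mult_INR; reflexivity. Qed.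

Lemma RtoC_INR_fact_neq_0 n : RtoC (INR (fact n)) <> 0.
Proof. intros H; apply RtoC_inj in H; exact (INR_fact_neq_0 n H). Qed.

Lemma Re_pos_neq_0 z : (0 < Re z)%R -> z <> 0.
Proof. intros H ->; simpl in H; lra. Qed.

Lemma Re_plus_INR_pos z n : (0 < Re z)%R -> (0 < Re (z + INR n))%R.
Proof.
intros H; change (0 < Re z + INR n)%R; pose proof (pos_INR n); lra.
Qed.

Lemma rising_neq_0 z n : (0 < Re z)%R -> rising z n <> 0.
Proof.
intros H; induction n as [|n IH]; simpl.
- intros E; apply RtoC_inj in E; lra.
- apply Cmult_neq_0; [ exact IH | apply Re_pos_neq_0, Re_plus_INR_pos, H ].
Qed.

Lemma rising_shift z n : z * rising (z + 1) n = rising z (S n).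
Proof.
induction n as [|n IH].
- simpl; ring.
- change (rising (z + 1) (S n)) with (rising (z + 1) n * (z + 1 + INR n)).
  change (rising z (S (S n))) with (rising z (S n) * (z + INR (S n))).
  rewrite <- IH, RtoC_INR_S; ring.
Qed.

Lemma rising_1 n : rising 1 n = INR (fact n).
Proof.
induction n as [|n IH]; [ reflexivity | ].
rewrite RtoC_INR_fact_S, RtoC_INR_S; simpl; rewrite IH; ring.
Qed.

(** This is (-x)_j = (-1)^j x! / (x-j)! for x = k + j, cleared of
    denominators; in this form k grows by one in the induction on j. *)
Lemma rising_neg_INR (k j : nat) :
  rising (- INR (k + j)) j * INR (fact k) = (- (1)) ^ j * INR (fact (k + j)).
Proof.
revert k; induction j as [|j IH]; intros k.
- rewrite Nat.add_0_r; simpl; ring.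
- rewrite <- Nat.add_succ_comm; specialize (IH (S k)).
  change (rising (- INR (S k + j)) (S j))
    with (rising (- INR (S k + j)) j * (- INR (S k + j) + INR j)).
  rewrite Cpow_S, <- (Cmult_assoc (- (1))), <- IH, RtoC_INR_fact_S.
  rewrite (plus_INR (S k) j), RtoC_plus; ring.
Qed.

Lemma rising_neg_INR_eq_0 (x j : nat) : (x < j)%nat -> rising (- INR x) j = 0.
Proof.
induction 1 as [|j _ IH]; simpl.
- ring.
- rewrite IH; ring.
Qed.

(** * Gauss's product and the functional equation of Gamma *)

(** The sequence whose limit is [CGamma]. *)
Definition gauss (z : C) (n : nat) : C :=
  INR (fact n) * Cexp (z * ln (INR n)) / rising z (S n).

Lemma gauss_neq_0 z n : (0 < Re z)%R -> gauss z n <> 0.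
Proof.
intros H; apply Cmult_neq_0.
- apply Cmult_neq_0; [ apply RtoC_INR_fact_neq_0 | apply Cexp_neq_0 ].
- intros H0; pose proof (Cinv_r _ (rising_neq_0 z (S n) H)) as E.
  rewrite H0, Cmult_0_r in E; apply RtoC_inj in E; lra.
Qed.

(** The relative difference between consecutive terms of Gauss's sequence:
    1 + [gauss_defect z n] = gauss z n / gauss z (n+1).  The quotient is taken in
    this direction to keep z + n + 1 out of the denominator. *)
Definition gauss_defect (z : C) (n : nat) : C :=
  Cexp (- (z * RtoC (ln (INR (S n)) - ln (INR n)))) * (1 + z * RtoC (/ INR (S n))) - 1.

Lemma gauss_step z n :
  (0 < Re z)%R -> gauss z n = gauss z (S n) * (1 + gauss_defect z n).
Proof.
intros H; unfold gauss, gauss_defect.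
change (rising z (S (S n))) with (rising z (S n) * (z + INR (S n))).
rewrite RtoC_INR_fact_S, RtoC_minus, RtoC_inv by apply not_0_INR, Nat.neq_succ_0.
replace (z * RtoC (ln (INR n))) with
  (z * RtoC (ln (INR (S n))) + - (z * (RtoC (ln (INR (S n))) - RtoC (ln (INR n))))) by ring.
rewrite Cexp_plus; field; repeat split.
- apply RtoC_INR_S_neq_0.
- apply Re_pos_neq_0, Re_plus_INR_pos, H.
- apply rising_neq_0, H.
Qed.

(** Both bounds are instances of ln t <= t - 1. *)
Lemma ln_increment_bounds n :
  (1 <= n)%nat -> (/ INR (S n) <= ln (INR (S n)) - ln (INR n) <= / INR n)%R.
Proof.
intros Hn.
assert (Hp : (0 < INR n)%R) by (apply lt_0_INR; lia).
assert (Hs : (0 < INR (S n))%R) by (apply lt_0_INR; lia).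
assert (Hln : forall x y, (0 < x)%R -> (0 < y)%R -> (ln y - ln x <= (y - x) / x)%R).
{ intros x y Hx Hy.
  pose proof (exp_ineq1_le (ln y - ln x)) as E.
  unfold Rminus in E; rewrite exp_plus, exp_Ropp, !exp_ln in E by assumption.
  replace ((y - x) / x)%R with (y * / x - 1)%R by (field; lra); lra. }
pose proof (Hln _ _ Hp Hs) as H1; pose proof (Hln _ _ Hs Hp) as H2.
rewrite S_INR in *; split.
- replace ((INR n - (INR n + 1)) / (INR n + 1))%R with (- / (INR n + 1))%R in H2
    by (field; lra); lra.
- replace ((INR n + 1 - INR n) / INR n)%R with (/ INR n)%R in H1 by (field; lra); lra.
Qed.

(** With h = 1/(n+1) and L = ln((n+1)/n), expanding exp(-zL) to first order
    gives  exp(-zL) (1 + zh) - 1 = z (h - L) - z^2 h L + E (1 + zh)  with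
    |E| <= 3 |zL|^2.  As h <= L <= 1/n, every term is O(h/n); the bound is
    expressed through h/n = 1/n - 1/(n+1) because that telescopes. *)
Lemma gauss_defect_bound z n :
  (1 <= n)%nat -> (2 * Cmod z <= INR n)%R ->
  (Cmod (gauss_defect z n)
   <= (Cmod z + 13 * Cmod z ^ 2) * (/ INR n - / INR (S n)))%R.
Proof.
intros Hn Hz.
destruct (ln_increment_bounds n Hn) as [HL1 HL2].
unfold gauss_defect.
set (L := (ln (INR (S n)) - ln (INR n))%R) in *.
assert (Hp : (1 <= INR n)%R) by (apply (le_INR 1); exact Hn).
assert (Hk : (/ INR n * INR n = 1)%R) by (field; lra).
assert (Hh : (/ INR (S n) * (INR n + 1) = 1)%R) by (rewrite S_INR; field; lra).
set (h := (/ INR (S n))%R) in *; set (k := (/ INR n)%R) in *.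
assert (Hh0 : (0 < h)%R) by nra.
assert (Hhk : (k - h = h * k)%R) by nra.
assert (Hk2 : (k <= 2 * h)%R) by nra.
set (M := Cmod z) in *.
assert (HM : (0 <= M)%R) by apply Cmod_ge_0.
assert (HMk : (M * k <= 1 / 2)%R) by nra.
assert (HmL : (Cmod (- (z * RtoC L)) = M * L)%R).
{ rewrite Cmod_opp, Cmod_mult, Cmod_R, Rabs_pos_eq by lra; reflexivity. }
pose proof (Cexp_sub_one_le (- (z * RtoC L))) as HE.
rewrite HmL in HE; specialize (HE ltac:(nra)).
set (E := Cexp (- (z * RtoC L)) - 1 - - (z * RtoC L)) in *.
replace (Cexp (- (z * RtoC L)) * (1 + z * RtoC h) - 1)
  with (z * RtoC (h - L) + (- (z * z * RtoC (h * L)) + E * (1 + z * RtoC h)))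
  by (unfold E; rewrite RtoC_minus, RtoC_mult; ring).
assert (T1 : (Cmod (z * RtoC (h - L)) <= M * (h * k))%R).
{ rewrite Cmod_mult, Cmod_R; apply Rmult_le_compat_l; [ exact HM | ].
  apply Rabs_le; lra. }
assert (T2 : (Cmod (- (z * z * RtoC (h * L))) <= M ^ 2 * (h * k))%R).
{ rewrite Cmod_opp, !Cmod_mult, Cmod_R, Rabs_pos_eq by nra; fold M.
  replace (M * M)%R with (M ^ 2)%R by ring.
  apply Rmult_le_compat_l; [ apply pow2_ge_0 | nra ]. }
assert (T3 : (Cmod (1 + z * RtoC h) <= 2)%R).
{ eapply Rle_trans; [ apply Cmod_triangle | ].
  rewrite Cmod_1, Cmod_mult, Cmod_R, Rabs_pos_eq by lra; fold M; nra. }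
assert (T4 : (Cmod (E * (1 + z * RtoC h)) <= 12 * M ^ 2 * (h * k))%R).
{ rewrite Cmod_mult.
  assert ((M * L) ^ 2 <= 2 * (M ^ 2 * (h * k)))%R.
  { replace ((M * L) ^ 2)%R with (M ^ 2 * L ^ 2)%R by ring.
    assert (L ^ 2 <= 2 * (h * k))%R by nra.
    pose proof (pow2_ge_0 M); nra. }
  pose proof (Cmod_ge_0 E); pose proof (Cmod_ge_0 (1 + z * RtoC h)); nra. }
rewrite Hhk.
eapply Rle_trans; [ apply Cmod_triangle | ].
pose proof (Cmod_triangle (- (z * z * RtoC (h * L))) (E * (1 + z * RtoC h))).
lra.
Qed.

Lemma is_lim_seq_inv_INR : is_lim_seq (fun n => / INR n)%R 0.
Proof. exact (is_lim_seq_inv _ _ is_lim_seq_INR ltac:(discriminate)). Qed.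

Lemma ex_series_inv_INR_increments (K : R) N :
  ex_series (fun n => K * (/ INR (n + N) - / INR (S (n + N))))%R.
Proof.
apply (ex_series_scal_l K (fun n => / INR (n + N) - / INR (S (n + N)))%R).
exists (/ INR N)%R.
change (is_lim_seq (sum_n (fun n => / INR (n + N) - / INR (S (n + N)))%R) (/ INR N)%R).
assert (H0 : is_lim_seq (fun n => / INR N - / INR (S n + N))%R (/ INR N - 0)%R).
{ apply is_lim_seq_minus'; [ apply is_lim_seq_const | ].
  apply (is_lim_seq_incr_1 (fun n => / INR (n + N))%R).
  apply (is_lim_seq_incr_n (fun n => / INR n)%R N), is_lim_seq_inv_INR. }
rewrite Rminus_0_r in H0; refine (is_lim_seq_ext _ _ _ _ H0); intros n.
rewrite (sum_n_ext _ (fun k => - / INR (S k + N) - - / INR (k + N))%R).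
- rewrite (sum_n_increments (fun k => - / INR (k + N))%R); simpl; ring.
- intros k; simpl; ring.
Qed.

(** Discarding the first N terms makes the defects at most 1/2, as
    [Ccv_nonzero_of_summable_ratios] requires. *)
Lemma CGamma_spec z : (0 < Re z)%R -> CGamma z <> 0 /\ Ccv (gauss z) (CGamma z).
Proof.
intros H.
set (K := (Cmod z + 13 * Cmod z ^ 2)%R).
assert (HK : (0 <= K)%R).
{ unfold K; pose proof (Cmod_ge_0 z); pose proof (pow2_ge_0 (Cmod z)); lra. }
(* n >= 2|z| is needed for the defect bound, and n >= 2K turns K/n into at
   most 1/2. *)
destruct (INR_archimed 1 (2 * Cmod z + 2 * K + 1) Rlt_0_1) as [N HN].
rewrite Rmult_1_r in HN.
assert (HN1 : (1 <= N)%nat).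
{ apply INR_le; change (INR 1) with 1%R; pose proof (Cmod_ge_0 z); lra. }
destruct (Ccv_nonzero_of_summable_ratios (fun n => gauss z (n + N))
   (fun n => gauss_defect z (n + N))
   (fun n => K * (/ INR (n + N) - / INR (S (n + N))))%R) as [l [Hl0 Hl]].
- apply ex_series_inv_INR_increments.
- intros n; split.
  + apply gauss_defect_bound; [ lia | ].
    rewrite plus_INR; pose proof (pos_INR n); lra.
  + assert (Hp : (2 * K + 1 <= INR (n + N))%R).
    { rewrite plus_INR; pose proof (pos_INR n); pose proof (Cmod_ge_0 z); lra. }
    assert (0 < / INR (S (n + N)))%R by (apply Rinv_0_lt_compat, lt_0_INR; lia).
    assert (/ INR (n + N) * INR (n + N) = 1)%R by (field; lra).
    assert (0 < / INR (n + N))%R by (apply Rinv_0_lt_compat; lra).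
    nra.
- intros n; apply gauss_neq_0, H.
- intros n; apply gauss_step, H.
- apply Ccv_of_shift in Hl.
  replace (CGamma z) with l by (symmetry; apply Ccv_Clim_seq, Hl).
  now split.
Qed.

Lemma CGamma_neq_0 z : (0 < Re z)%R -> CGamma z <> 0.
Proof. apply CGamma_spec. Qed.

(** This ratio is the correction factor between gauss (z+1) and z gauss z.  The
    boundary case z = 0 serves to evaluate Gamma at 1. *)
Lemma Ccv_ratio_shift z : (0 <= Re z)%R -> Ccv (fun n => INR n / (z + INR (S n))) 1.
Proof.
intros H.
apply (Ccv_of_dist_le _ _ (fun n => Cmod (z + 1) * / INR n)%R).
- exists 1%nat; intros n Hn.
  assert (Hp : (0 < INR n)%R) by (apply lt_0_INR; lia).
  assert (Hd : z + INR (S n) <> 0).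
  { apply Re_pos_neq_0; change (0 < Re z + INR (S n))%R; rewrite S_INR; lra. }
  replace (INR n / (z + INR (S n)) - 1) with (- ((z + 1) * / (z + INR (S n)))).
  + rewrite Cmod_opp, Cmod_mult, Cmod_inv by exact Hd.
    apply Rmult_le_compat_l; [ apply Cmod_ge_0 | ].
    apply Rinv_le_contravar; [ exact Hp | ].
    eapply Rle_trans; [ | apply re_le_Cmod ].
    change (Re (z + INR (S n))) with (Re z + INR (S n))%R.
    rewrite S_INR; rewrite Rabs_pos_eq; lra.
  + rewrite RtoC_INR_S in *; field; exact Hd.
- replace (Finite 0) with (Finite (Cmod (z + 1) * 0)) by (f_equal; ring).
  apply is_lim_seq_mult'; [ apply is_lim_seq_const | apply is_lim_seq_inv_INR ].
Qed.

Lemma CGamma_succ z : (0 < Re z)%R -> CGamma (z + 1) = z * CGamma z.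
Proof.
intros H.
assert (Hz1 : (0 < Re (z + 1))%R) by (change (0 < Re z + 1)%R; lra).
apply (Ccv_unique (gauss (z + 1))); [ now apply CGamma_spec | ].
rewrite <- (Cmult_1_r (z * CGamma z)).
refine (Ccv_ext_loc _ _ _ _ (Ccv_mult _ _ _ _
  (Ccv_mult _ _ _ _ (Ccv_const z) (proj2 (CGamma_spec z H))) (Ccv_ratio_shift z (Rlt_le _ _ H)))).
exists 1%nat; intros n Hn; unfold gauss.
assert (Hp : (0 < INR n)%R) by (apply lt_0_INR; lia).
replace ((z + 1) * RtoC (ln (INR n))) with (z * RtoC (ln (INR n)) + RtoC (ln (INR n)))
  by ring.
rewrite Cexp_plus, Cexp_RtoC, exp_ln by exact Hp.
assert (E : z * rising (z + 1) (S n) = rising z (S n) * (z + INR (S n)))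
  by apply rising_shift.
assert (Hr : rising (z + 1) (S n) = rising z (S n) * (z + INR (S n)) / z).
{ rewrite <- E; field; apply Re_pos_neq_0, H. }
rewrite Hr; field; repeat split.
- apply Re_pos_neq_0, H.
- apply Re_pos_neq_0, Re_plus_INR_pos, H.
- apply rising_neq_0, H.
Qed.

Lemma CGamma_plus_INR z j : (0 < Re z)%R -> CGamma (z + INR j) = rising z j * CGamma z.
Proof.
intros H; induction j as [|j IH].
- simpl; rewrite Cplus_0_r; ring.
- rewrite RtoC_INR_S, Cplus_assoc, CGamma_succ by now apply Re_plus_INR_pos.
  rewrite IH; simpl; ring.
Qed.

Lemma CGamma_1 : CGamma 1 = 1.
Proof.
assert (H : (0 < Re 1)%R) by (simpl; lra).
apply (Ccv_unique (gauss 1)); [ now apply CGamma_spec | ].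
refine (Ccv_ext_loc _ _ _ _ (Ccv_ratio_shift 0 (Rle_refl 0))).
exists 1%nat; intros n Hn; unfold gauss.
assert (Hp : (0 < INR n)%R) by (apply lt_0_INR; lia).
rewrite Cmult_1_l, Cexp_RtoC, exp_ln by exact Hp.
rewrite rising_1, RtoC_INR_fact_S, Cplus_0_l; field; split.
- apply RtoC_INR_fact_neq_0.
- apply RtoC_INR_S_neq_0.
Qed.

(** * Finite sums of complex numbers *)

(** These lemmas fix the carrier of [sum_n] to [C] itself rather than to the
    carrier of an algebraic structure, so that [ring] applies after rewriting. *)
Lemma sum_n_ext_le (F G : nat -> C) n :
  (forall i, (i <= n)%nat -> F i = G i) -> sum_n F n = sum_n G n :> C.
Proof. exact (sum_n_ext_loc F G n). Qed.

Lemma sum_n_add (F G : nat -> C) n :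
  sum_n (fun i => F i + G i) n = sum_n F n + sum_n G n :> C.
Proof. exact (sum_n_plus F G n). Qed.

Lemma sum_n_last (F : nat -> C) n : sum_n F (S n) = sum_n F n + F (S n) :> C.
Proof. exact (sum_Sn F n). Qed.

Lemma sum_n_first (F : nat -> C) n : sum_n F (S n) = F O + sum_n (fun i => F (S i)) n :> C.
Proof.
induction n as [|n IH].
- now rewrite sum_n_last, !sum_O.
- rewrite sum_n_last, IH, (sum_n_last _ n); ring.
Qed.

Lemma sum_n_reverse (F : nat -> C) n : sum_n (fun i => F (n - i)%nat) n = sum_n F n :> C.
Proof.
induction n as [|n IH].
- now rewrite !sum_O.
- rewrite sum_n_first, sum_n_last, <- IH, Nat.sub_0_r; apply Cplus_comm.
Qed.

Lemma sum_n_scale (c : C) (F : nat -> C) n : sum_n (fun i => c * F i) n = c * sum_n F n :> C.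
Proof. exact (sum_n_mult_l (K := C_Ring) c F n). Qed.

Lemma is_series_finite_support (F : nat -> C) x :
  (forall j, (x < j)%nat -> F j = 0) ->
  is_series (F : nat -> C_NormedModule) (sum_n F x).
Proof.
intros H0.
assert (H : forall n, (x <= n)%nat -> sum_n F n = sum_n F x :> C).
{ induction 1 as [|n Hn IH]; [ reflexivity | ].
  rewrite sum_n_last, IH, H0 by lia; apply Cplus_0_r. }
apply (filterlim_ext_loc (fun _ => sum_n F x)).
- exists x; intros n Hn; symmetry; exact (H n Hn).
- apply filterlim_const.
Qed.

(** * Fractional sums and their differences *)

(** The coefficient of X^j in (1 - X)^(-s). *)
Definition rising_coef (s : C) (j : nat) : C := rising s j / INR (fact j).

Lemma rising_coef_0 s : rising_coef s 0 = 1.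
Proof. unfold rising_coef; simpl; field. Qed.

(** Coefficientwise form of (1 - X) (1 - X)^(-s) = (1 - X)^(-(s-1)). *)
Lemma rising_coef_S_sub s j :
  rising_coef s (S j) - rising_coef s j = rising_coef (s - 1) (S j).
Proof.
unfold rising_coef.
rewrite <- (rising_shift (s - 1)); replace (s - 1 + 1) with s by ring.
rewrite RtoC_INR_fact_S, RtoC_INR_S; simpl rising; field; split.
- apply RtoC_INR_fact_neq_0.
- rewrite <- RtoC_INR_S; apply RtoC_INR_S_neq_0.
Qed.

(** The fractional sum of order s of f from b.  It is 0 for t < b, which is what
    makes [nabla_rising_conv] hold at t = b as well. *)
Definition rising_conv (s : C) (b : Z) (f : Z -> C) (t : Z) : C :=
  sumZ b t (fun k => rising_coef s (Z.to_nat (t - k)) * f k).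

Lemma sumZ_neg b t F : (t < b)%Z -> sumZ b t F = 0.
Proof. intros H; unfold sumZ; now rewrite (proj2 (Z.ltb_lt t b) H). Qed.

Lemma sumZ_nat b m F :
  sumZ b (b + Z.of_nat m) F = sum_n (fun i => F (b + Z.of_nat i)%Z) m.
Proof.
unfold sumZ; rewrite (proj2 (Z.ltb_ge _ _)) by lia.
now rewrite Z.add_simpl_l, Nat2Z.id.
Qed.

Lemma rising_conv_nat s b f m :
  rising_conv s b f (b + Z.of_nat m)
  = sum_n (fun i => rising_coef s (m - i) * f (b + Z.of_nat i)%Z) m.
Proof.
unfold rising_conv; rewrite sumZ_nat; apply sum_n_ext; intros i.
do 2 f_equal; lia.
Qed.

(** The last term of the sum at t is unaffected by the order, the coefficient of
    index 0 being 1; the others change by [rising_coef_S_sub]. *)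
Lemma nabla_rising_conv s b f t :
  nabla (rising_conv s b f) t = rising_conv (s - 1) b f t.
Proof.
unfold nabla.
destruct (Z.lt_ge_cases t b) as [H|H].
- unfold rising_conv; rewrite !sumZ_neg by lia; ring.
- replace t with (b + Z.of_nat (Z.to_nat (t - b)))%Z by lia.
  destruct (Z.to_nat (t - b)) as [|m].
  + rewrite !rising_conv_nat, !sum_O; simpl.
    unfold rising_conv; rewrite sumZ_neg, !rising_coef_0 by lia; ring.
  + replace (b + Z.of_nat (S m) - 1)%Z with (b + Z.of_nat m)%Z by lia.
    rewrite !rising_conv_nat, !sum_n_last, Nat.sub_diag, !rising_coef_0.
    rewrite (sum_n_ext_le (fun i => rising_coef (s - 1) (S m - i) * f (b + Z.of_nat i)%Z)
      (fun i => rising_coef s (S m - i) * f (b + Z.of_nat i)%Z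
         + (- (1)) * (rising_coef s (m - i) * f (b + Z.of_nat i)%Z))).
    * rewrite sum_n_add, sum_n_scale; ring.
    * intros i Hi; rewrite Nat.sub_succ_l by exact Hi.
      rewrite <- rising_coef_S_sub; ring.
Qed.

Lemma iter_nabla_ext g h n :
  (forall t, g t = h t) -> forall t, Nat.iter n nabla g t = Nat.iter n nabla h t.
Proof.
intros E; induction n as [|n IH]; intros t; simpl; [ apply E | ].
unfold nabla at 1 3; now rewrite !IH.
Qed.

Lemma iter_nabla_scale c g n t :
  Nat.iter n nabla (fun s => c * g s) t = c * Nat.iter n nabla g t.
Proof.
revert t; induction n as [|n IH]; intros t; simpl; [ reflexivity | ].
unfold nabla at 1 3; rewrite !IH; ring.
Qed.

Lemma iter_nabla_rising_conv s b f n t :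
  Nat.iter n nabla (rising_conv s b f) t = rising_conv (s - INR n) b f t.
Proof.
revert t; induction n as [|n IH]; intros t.
- change (INR 0) with 0%R; unfold Nat.iter; simpl; f_equal; ring.
- rewrite RtoC_INR_S; replace (s - (INR n + 1)) with (s - INR n - 1) by ring.
  rewrite <- nabla_rising_conv; simpl; unfold nabla; now rewrite !IH.
Qed.

Lemma Cpoch_nat s (j : nat) :
  (0 < Re s)%R -> Cpoch (IZR (Z.of_nat j + 1)) (s - 1) = CGamma s * rising_coef s j.
Proof.
intros H; unfold Cpoch, rising_coef.
rewrite plus_IZR, <- INR_IZR_INZ, RtoC_plus.
replace (INR j + 1 + (s - 1)) with (s + INR j) by ring.
assert (H1 : (0 < Re 1)%R) by (simpl; lra).
rewrite (Cplus_comm (INR j)), !CGamma_plus_INR, CGamma_1, rising_1 by assumption.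
field; apply RtoC_INR_fact_neq_0.
Qed.

Lemma Re_diff_order_pos mu : (0 < Re (INR (diff_order mu) - mu))%R.
Proof.
change (0 < INR (diff_order mu) - Re mu)%R; unfold diff_order.
destruct (archimed (Re mu)) as [H _].
assert (IZR (up (Re mu)) <= INR (Z.to_nat (up (Re mu))))%R; [ | lra ].
rewrite INR_IZR_INZ; apply IZR_le; lia.
Qed.

(** For every f, the difference of order mu is the fractional sum of order -mu:
    the regularisation by n only serves to move the argument of Gamma into the
    half-plane of positive real part. *)
Lemma gray_zhang_eq mu b f x :
  gray_zhang mu b f (b + Z.of_nat x)
  = sum_n (fun i => rising_coef (- mu) (x - i) * f (b + Z.of_nat i)%Z) x.
Proof.
unfold gray_zhang; cbv zeta.
pose proof (Re_diff_order_pos mu) as Hs.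
set (n := diff_order mu) in *; set (s := INR n - mu) in *.
rewrite (iter_nabla_ext _ (fun t => CGamma s * rising_conv s b f t)).
- rewrite iter_nabla_scale, iter_nabla_rising_conv, Cmult_assoc.
  rewrite Cinv_l, Cmult_1_l by now apply CGamma_neq_0.
  rewrite rising_conv_nat; unfold s; now replace (INR n - mu - INR n) with (- mu) by ring.
- intros t; destruct (Z.lt_ge_cases t b) as [H|H].
  + unfold rising_conv; rewrite !sumZ_neg by exact H; ring.
  + replace t with (b + Z.of_nat (Z.to_nat (t - b)))%Z by lia.
    set (m := Z.to_nat (t - b)).
    rewrite rising_conv_nat, sumZ_nat, <- sum_n_scale.
    apply sum_n_ext_le; intros i Hi.
    replace (b + Z.of_nat m - (b + Z.of_nat i) + 1)%Z
      with (Z.of_nat (m - i) + 1)%Z by lia.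
    rewrite Cpoch_nat by exact Hs; ring.
Qed.

(** * The fractional Charlier function *)

Theorem proposition3p19 (a : C) (ha : a <> 0) (mu : C) (x : nat) :
  is_hyp2F0 (- mu) (- INR x) (- (1 / a)) (charlier mu x a).
Proof.
unfold is_hyp2F0.
replace (charlier mu x a) with (sum_n (hyp2F0_term (- mu) (- INR x) (- (1 / a))) x).
- apply is_series_finite_support; intros j Hj; unfold hyp2F0_term.
  rewrite (rising_neg_INR_eq_0 x j Hj); unfold Cdiv; ring.
- unfold charlier.
  rewrite <- (Z.add_0_l (Z.of_nat x)), gray_zhang_eq, <- sum_n_scale, <- sum_n_reverse.
  apply sum_n_ext_le; intros i Hi.
  rewrite Z.add_0_l, Nat2Z.id; unfold hyp2F0_term, rising_coef.
  pose proof (rising_neg_INR i (x - i)) as E.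
  replace (i + (x - i))%nat with x in E by lia.
  replace (Cpow a x) with (Cpow a i * Cpow a (x - i)) by (rewrite <- Cpow_add_r; f_equal; lia).
  assert (E' : rising (- INR x) (x - i)
     = (- (1)) ^ (x - i) * INR (fact x) / INR (fact i)).
  { rewrite <- E; field; apply RtoC_INR_fact_neq_0. }
  assert (Hp : (- (1)) ^ (x - i) * (- (1 / a)) ^ (x - i) * a ^ (x - i) = 1).
  { rewrite <- !Cpow_mult_l.
    replace (- (1) * - (1 / a) * a) with (RtoC 1) by (field; exact ha).
    apply Cpow_1_l. }
  rewrite E'.
  (* The powers of -1, -1/a and a are grouped because [field] does not cancel
     powers with a symbolic exponent. *)
  transitivity (rising (- mu) (x - i) * INR (fact x) / INR (fact i) / INR (fact (x - i))
     * ((- (1)) ^ (x - i) * (- (1 / a)) ^ (x - i) * a ^ (x - i)) / a ^ (x - i)).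
  + field; repeat split; try apply RtoC_INR_fact_neq_0; now apply Cpow_nz.
  + rewrite Hp; field; repeat split; try apply RtoC_INR_fact_neq_0; now apply Cpow_nz.
Qed.
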